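(* Let $n,m$ be positive integers. Suppose that $\mathbb{R}P^{n-1}$ cannot be embedded into $\mathbb{R}^m$ because of the deleted square obstruction, i.e. there is no $\mathbb{Z}_2$-equivariant continuous map $$\left(\mathbb{R}P^{n-1}\times\mathbb{R}P^{n-1}\right)\setminus\Delta(\mathbb{R}P^{n-1})\to S^{m-1}.$$ Then $(n,m,2)\in\mathcal{R}_{odd,sym}^{orth}$.
   Context: For a space $M$, $\Delta(M)\subset M\times M$ is the diagonal; $\mathbb{Z}_2$ acts on the deleted square $(M\times M)\setminus\Delta(M)$ by interchanging coordinates and on $S^{m-1}$ antipodally. The deleted square obstruction to an embedding $M\to\mathbb{R}^m$ is the obstruction to the existence of a $\mathbb{Z}_2$-equivariant map $(M\times M)\setminus\Delta(M)\to S^{m-1}$. A continuous function $f:S^{n-1}\times S^{n-1}\to\mathbb{R}$ is called odd if $f(-x,y)=-f(x,y)$ and $f(x,-y)=-f(x,y)$ for all $x,y$, and symmetric if $f(x,y)=f(y,x)$ for all $x,y$. $\mathcal{R}_{odd,sym}^{orth}$ is the set of triples $(n,m,k)$ of positive integers such that for any $m$ odd and symmetric functions $f_1,\ldots,f_m:S^{n-1}\times S^{n-1}\to\mathbb{R}$ there exists an orthonormal $k$-frame $(e_1,\ldots,e_k)$ in $\mathbb{R}^n$ with $f_l(e_i,e_j)=0$ for all $1\le l\le m$ and $1\le i<j\le k$. *)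

(* Defs.v *)
From HB Require Import structures.
From mathcomp Require Import all_boot all_order all_algebra.
From mathcomp Require Import all_classical all_reals all_analysis.
Set Implicit Arguments.
Unset Strict Implicit.
Unset Printing Implicit Defensive.
Import Order.TTheory GRing.Theory Num.Theory.
Import numFieldNormedType.Exports.
Local Open Scope classical_set_scope.
Local Open Scope ring_scope.
Local Open Scope quotient_scope.

Definition dotprod (R : realType) (n : nat) (u v : 'rV[R]_n) : R :=
  \sum_(i < n) u 0 i * v 0 i.

(* [sphere R n] is the Euclidean unit sphere $S^{n-1}$ of $R^n$: the index is
   the dimension of the ambient space.  The norm of ['rV[R]_n] in
   MathComp-Analysis is the sup norm, whence the inner product here; both
   norms induce the same topology.  As a type, [sphere R n] carries the
   subspace topology. *)
Definition sphere (R : realType) (n : nat) : set 'rV[R]_n :=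
  [set x | dotprod x x = 1].
Arguments sphere : clear implicits.

Lemma sphereN (R : realType) (n : nat) (x : sphere R n) :
  - val x \in sphere R n.
Proof.
case: x => x /= /set_mem xS; apply/mem_set; rewrite /sphere /= -xS.
by apply: eq_bigr => i _; rewrite !mxE mulrNN.
Qed.

Definition antipode (R : realType) (n : nat) (x : sphere R n) : sphere R n :=
  exist _ (- val x) (sphereN x).

Lemma antipodeK (R : realType) (n : nat) : involutive (@antipode R n).
Proof. by move=> x; apply: val_inj; rewrite /= opprK. Qed.

Definition antipodal (R : realType) (n : nat) : rel (sphere R n) :=
  fun x y => (x == y) || (x == antipode y).

Lemma antipodal_equiv (R : realType) (n : nat) :
  equiv_class_of (@antipodal R n).
Proof.
have imp (x y : sphere R n) : antipodal x y -> antipodal y x.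
  rewrite /antipodal => /orP[/eqP->|/eqP->]; first by rewrite eqxx.
  by rewrite antipodeK eqxx orbT.
split; first by move=> x; rewrite /antipodal eqxx.
  by move=> x y; apply/idP/idP; exact: imp.
rewrite /antipodal => y x z /orP[/eqP-> //|/eqP->] /orP[/eqP->|/eqP->].
  by rewrite eqxx orbT.
by rewrite antipodeK eqxx.
Qed.

Canonical antipodal_equivRel (R : realType) (n : nat) : equiv_rel (sphere R n) :=
  EquivRelPack (@antipodal_equiv R n).

(* [projective_space R n] is $\mathbb{R}P^{n-1}$, the quotient of $S^{n-1}$ by
   the antipodal relation, with the quotient topology. *)
Definition projective_space (R : realType) (n : nat) : topologicalType :=
  quotient_topology {eq_quot (@antipodal R n)}.

Definition deleted_square (M : Type) : set (M * M) := ~` diagonal.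
Arguments deleted_square : clear implicits.

Lemma deleted_square_swap (M : choiceType) (p : deleted_square M) :
  swap_pair (val p) \in deleted_square M.
Proof.
case: p => -[x y] /= /set_mem xy; apply/mem_set => yx; apply: xy.
by rewrite /diagonal /= in yx *.
Qed.

Definition deleted_swap (M : choiceType) (p : deleted_square M) :
    deleted_square M :=
  exist _ (swap_pair (val p)) (deleted_square_swap p).

Definition deleted_square_obstruction
    (R : realType) (M : topologicalType) (m : nat) : Prop :=
  ~ exists g : deleted_square M -> sphere R m,
      continuous g /\ {morph g : p / deleted_swap p >-> antipode p}.

Definition odd_on_spheres (R : realType) (n : nat)
    (f : sphere R n * sphere R n -> R) : Prop :=
  forall x y : sphere R n,
    f (antipode x, y) = - f (x, y) /\ f (x, antipode y) = - f (x, y).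

Definition symmetric_on_spheres (R : realType) (n : nat)
    (f : sphere R n * sphere R n -> R) : Prop :=
  forall x y : sphere R n, f (x, y) = f (y, x).

(* Frame vectors are taken in [sphere R n], so that functions on spheres apply
   to them directly; the case [i = j] below is then automatic. *)
Definition orthonormal_frame (R : realType) (n k : nat)
    (e : 'I_k -> sphere R n) : Prop :=
  forall i j : 'I_k, dotprod (val (e i)) (val (e j)) = (i == j)%:R.

Definition R_odd_sym_orth (R : realType) : set (nat * nat * nat) :=
  [set t | let: (n, m, k) := t in
    [/\ (0 < n)%N, (0 < m)%N, (0 < k)%N &
      forall f : 'I_m -> sphere R n * sphere R n -> R,
        (forall l, [/\ continuous (f l), odd_on_spheres (f l)
                     & symmetric_on_spheres (f l)]) ->
        exists2 e : 'I_k -> sphere R n, orthonormal_frame e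
          & forall (l : 'I_m) (i j : 'I_k), (i < j)%N -> f l (e i, e j) = 0]].

(* Main.v *)
Require Import Defs.
From HB Require Import structures.
From mathcomp Require Import all_boot all_order all_algebra.
From mathcomp Require Import all_classical all_reals all_analysis.
From mathcomp Require Import ring.
Set Implicit Arguments.
Unset Strict Implicit.
Unset Printing Implicit Defensive.
Import Order.TTheory GRing.Theory Num.Theory.
Import numFieldNormedType.Exports.
Local Open Scope classical_set_scope.
Local Open Scope ring_scope.
Local Open Scope quotient_scope.

(** The contrapositive holds: odd symmetric functions [f_1, ..., f_m] with no
common zero on orthonormal pairs yield an equivariant map from the deleted
square of the projective space to [S^(m-1)].

Two unit vectors [x], [y] spanning distinct lines have nonzero sum and
difference, and these are orthogonal since [|x| = |y|].  Let [u] and [v] be the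
normalizations of [x + y] and [x - y], and set
[F(x, y) = (f_1(u, v), ..., f_m(u, v))], a nonzero vector of [R^m].
- Exchanging [x] and [y] fixes [u] and negates [v], so oddness makes [F] change
  sign ([sum_diff_values_swap]).
- Replacing [x] by [-x] turns [(u, v)] into [(-v, -u)], so oddness (twice) and
  symmetry leave [F] unchanged ([sum_diff_values_antipode]); combined with the
  exchange, the same holds for [y].  Hence [F] depends only on the two lines
  ([sum_diff_values_pi]).
- The projection of the sphere onto the projective space is open
  ([nbhs_pi_projective]), hence so is its square, and the continuity of [F]
  passes to the deleted square ([deleted_square_continuous]).

The equivariant map is [F / |F|]. *)

(** * Continuity of maps into subspaces and into row vectors *)

Lemma continuous_at_set_type (X Y : topologicalType) (A : set Y) (h : X -> A)
    (x : X) :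
  {for x, continuous (set_val \o h)} -> {for x, continuous h}.
Proof.
move=> ch U [_ [[B oB <-] Bhx sBU]].
have nB : nbhs (set_val (h x)) B by apply: open_nbhs_nbhs.
have : \forall z \near x, B (set_val (h z)) by exact: ch.
by apply: filterS => z; exact: sBU.
Qed.

Lemma continuous_at_row (R : realType) (X : topologicalType) (n : nat)
    (h : 'I_n -> X -> R) (x : X) :
  (forall j, {for x, continuous (h j)}) ->
  {for x, continuous (fun z => \row_j h j z)}.
Proof.
move=> ch U [P nP sPU].
have : \forall z \near x, forall j, P 0 j (h j z).
  apply: filter_forall => j; apply: ch.
  by have := nP 0 j; rewrite mxE.
apply: filterS => z Pz; apply: sPU => i j.
by rewrite ord1 mxE.
Qed.

(** * The inner product and the direction of a nonzero vector *)

Section inner_product.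
Context {R : realType} {n : nat}.
Implicit Types (u v : 'rV[R]_n).

Lemma dotprod_continuous : continuous (fun v : 'rV[R]_n => dotprod v v).
Proof.
apply: continuous_big => [|i _ v]; first exact: add_continuous.
have ci : {for v, continuous (fun w : 'rV[R]_n => w 0 i)}.
  exact: coord_continuous.
exact: continuousM.
Qed.

Lemma dotprodC u v : dotprod u v = dotprod v u.
Proof. by apply: eq_bigr => i _; rewrite mulrC. Qed.

Lemma dotprodZl a u v : dotprod (a *: u) v = a * dotprod u v.
Proof.
by rewrite /dotprod mulr_sumr; apply: eq_bigr => i _; rewrite mxE mulrA.
Qed.

Lemma dotprodZr a u v : dotprod u (a *: v) = a * dotprod u v.
Proof. by rewrite dotprodC dotprodZl dotprodC. Qed.

Lemma dotprodDB u v : dotprod (u + v) (u - v) = dotprod u u - dotprod v v.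
Proof.
by rewrite /dotprod -sumrB; apply: eq_bigr => i _; rewrite !mxE; ring.
Qed.

Lemma dotprod_sphere (x : sphere R n) : dotprod (val x) (val x) = 1.
Proof. exact: set_mem (valP x). Qed.

Lemma dotprod_eq0 v : (dotprod v v == 0) = (v == 0).
Proof.
rewrite psumr_eq0 => [|i _]; last by rewrite -expr2 sqr_ge0.
apply/allP/eqP => [v0|-> i _]; last by rewrite mxE mulr0 eqxx.
apply/rowP => i; rewrite mxE; apply/eqP.
by have := v0 i (mem_index_enum i); rewrite mulf_eq0 orbb.
Qed.

Lemma dotprod_gt0 v : v != 0 -> 0 < dotprod v v.
Proof.
move=> v0; rewrite lt_neqAle eq_sym dotprod_eq0 v0.
by apply: sumr_ge0 => i _; rewrite -expr2 sqr_ge0.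
Qed.

(** The vector [v] divided by its Euclidean norm; zero is sent to zero. *)
Definition normalize v : 'rV[R]_n := (Num.sqrt (dotprod v v))^-1 *: v.

Lemma normalize_sphere v : v != 0 -> normalize v \in sphere R n.
Proof.
move=> /dotprod_gt0 v0; apply/mem_set.
rewrite /sphere /= dotprodZl dotprodZr mulrA -expr2 exprVn sqr_sqrtr ?ltW//.
by rewrite mulVf ?gt_eqF.
Qed.

End inner_product.

Section direction.
Context {R : realType} {n : nat}.
Implicit Types (u v : 'rV[R]_n.+1).

Lemma delta_sphere : (delta_mx 0 0 : 'rV[R]_n.+1) \in sphere R n.+1.
Proof.
apply/mem_set; rewrite /sphere /= /dotprod big_ord_recl big1 => [|i _].
  by rewrite !mxE !eqxx mulr1 addr0.
by rewrite !mxE /= mulr0.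
Qed.

(** The unit vector along [v], as a point of the sphere.  The zero vector is
sent to the first basis vector, an arbitrary value. *)
Definition direction v : sphere R n.+1 :=
  insubd (exist _ (delta_mx 0 0) delta_sphere : sphere R n.+1) (normalize v).

Lemma val_direction v : v != 0 -> val (direction v) = normalize v.
Proof. by move=> v0; rewrite val_insubd normalize_sphere. Qed.

Lemma directionN v : v != 0 -> direction (- v) = antipode (direction v).
Proof.
move=> v0; apply: val_inj; rewrite /= !val_direction ?oppr_eq0//.
rewrite /normalize -scalerN; congr ((Num.sqrt _)^-1 *: _).
by apply: eq_bigr => i _; rewrite !mxE mulrNN.
Qed.

Lemma direction_continuous_at v : v != 0 -> {for v, continuous direction}.
Proof.
move=> v0; apply: continuous_at_set_type.
have nv0 : \forall w \near v, w != 0.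
  have : \forall w \near v, dotprod w w != 0.
    apply: (@dotprod_continuous _ _ v [set a | a != 0]).
    by apply: open_nbhs_nbhs; split; [exact: open_neq|rewrite /= dotprod_eq0].
  by apply: filterS => w; rewrite dotprod_eq0.
have dirE w : w != 0 -> (set_val \o direction) w = normalize w.
  exact: val_direction.
rewrite /prop_for /continuous_at dirE//.
apply: (@cvg_trans _ (normalize @ nbhs v)).
  apply: (@near_eq_cvg _ _ (nbhs v)); near=> w.
  by rewrite dirE//; near: w.
apply: cvgZ; last exact: cvg_id.
apply: cvgV; first by rewrite sqrtr_eq0 -ltNge dotprod_gt0.
apply: (@continuous_comp _ _ _ (fun w => dotprod w w) (@Num.sqrt R)).
  exact: dotprod_continuous.
exact: sqrt_continuous.
Unshelve. all: by end_near. Qed.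

Lemma direction_orthogonal u v : u != 0 -> v != 0 -> dotprod u v = 0 ->
  dotprod (val (direction u)) (val (direction v)) = 0.
Proof.
move=> u0 v0 uv; rewrite (val_direction u0) (val_direction v0).
by rewrite dotprodZl dotprodZr uv !mulr0.
Qed.

End direction.

(** * Projective space and its deleted square *)

Section projective.
Context {R : realType} {n : nat}.
Local Notation S := (sphere R n).
Local Notation P := (projective_space R n).

Lemma antipode_continuous : continuous (@antipode R n).
Proof.
move=> x; apply: continuous_at_set_type.
apply: (@continuous_comp S 'rV[R]_n 'rV[R]_n set_val -%R).
  exact: initial_continuous.
exact: opp_continuous.
Qed.

Lemma pi_projectiveE (x y : S) :
  (\pi x = \pi y :> P) <-> x = y \/ x = antipode y.
Proof.
split=> [/eqmodP/orP[]/eqP|]; [by left|by right|].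
by move=> xy; apply/eqmodP/orP; case: xy => ->; [left|right].
Qed.

(** The projection [S -> P] is open: the saturation of [U] is the union of [U]
and its antipodal image. *)
Lemma nbhs_pi_projective (x : S) (A : set S) :
  nbhs x A -> nbhs (\pi x : P) ((\pi : S -> P) @` A).
Proof.
rewrite !nbhsE => -[U [oU Ux] UA].
exists ((\pi : S -> P) @` U); last exact: image_subset.
split; last by exists x.
rewrite /open /= /quotient_open.
rewrite [X in open X](_ : _ = U `|` @antipode R n @^-1` U).
  apply: openU => //; move/continuousP : antipode_continuous; exact.
apply/seteqP; split => [y [z Uz /esym/pi_projectiveE[->|->]]|y [Uy|Uy]] /=.
- by left.
- by right; rewrite /= antipodeK.
- by exists y.
- by exists (antipode y) => //; apply/pi_projectiveE; right.
Qed.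

(** A function on pairs of points of the sphere which, away from pairs on a
common line, is continuous and depends only on the two lines induces a
continuous function on the deleted square.  The induced function is written
with the representative [repr] of each line, a choice that need not be
continuous. *)
Lemma deleted_square_continuous (Z : topologicalType) (h : S * S -> Z) :
  (forall x y x' y' : S, \pi x = \pi x' :> P -> \pi y = \pi y' :> P ->
     \pi x <> \pi y :> P -> h (x, y) = h (x', y')) ->
  (forall x y : S, \pi x <> \pi y :> P -> {for (x, y), continuous h}) ->
  continuous (fun p : deleted_square P => h (repr (val p).1, repr (val p).2)).
Proof.
move=> h_pi h_cont p U hU.
case E: (val p) => [a b].
have ab : a <> b.
  move=> ab; have /set_mem := valP p.
  by rewrite E; apply; rewrite /diagonal /= ab.
move: hU; rewrite E => hU.
have [|[A B] [nA nB] /= ABU] := h_cont (repr a) (repr b) _ U hU.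
  by rewrite !reprK.
have nAB : nbhs (val p) (((\pi : S -> P) @` A) `*` ((\pi : S -> P) @` B)).
  rewrite E; exists ((\pi : S -> P) @` A, (\pi : S -> P) @` B) => //.
  split=> /=; [rewrite -[a]reprK|rewrite -[b]reprK];
  exact: nbhs_pi_projective.
have : \forall q \near p,
    (((\pi : S -> P) @` A) `*` ((\pi : S -> P) @` B)) (val q).
  by apply: initial_continuous.
apply: (@filterS _ _ (nbhs_filter p)) => q [[x Ax qx] [y By qy]] /=.
rewrite /= -(h_pi x y) ?reprK//; first exact: ABU.
rewrite qx qy => q12.
by have /set_mem := valP q; apply.
Qed.

End projective.

(** * The equivariant map of a family without zeros on orthonormal pairs *)

Section equivariant_map.
Context {R : realType} {n m : nat}.
Local Notation S := (sphere R n.+1).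
Local Notation P := (projective_space R n.+1).
Context (f : 'I_m.+1 -> S * S -> R).
Context (f_cont : forall l, continuous (f l)).
Context (f_odd : forall l, odd_on_spheres (f l)).
Context (f_sym : forall l, symmetric_on_spheres (f l)).
Context (f_nz : forall x y : S, dotprod (val x) (val y) = 0 ->
  exists l, f l (x, y) != 0).

(** The normalizations of [x + y] and [x - y]; an orthonormal pair when [x] and
[y] span distinct lines. *)
Definition sum_diff (p : S * S) : S * S :=
  (direction (val p.1 + val p.2), direction (val p.1 - val p.2)).

(** The vector whose direction is the equivariant map. *)
Definition sum_diff_values (p : S * S) : 'rV[R]_m.+1 :=
  \row_l f l (sum_diff p).

Lemma sum_neq0 (x y : S) : \pi x <> \pi y :> P -> val x + val y != 0.
Proof.
move=> xy; apply/eqP => xy0; apply: xy; apply/pi_projectiveE; right.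
by apply: val_inj; rewrite /= -[LHS](addrK (val y)) xy0 sub0r.
Qed.

Lemma diff_neq0 (x y : S) : \pi x <> \pi y :> P -> val x - val y != 0.
Proof.
move=> xy; rewrite subr_eq0; apply/eqP => xy0; apply: xy.
by rewrite (val_inj xy0).
Qed.

Lemma sum_diff_orthogonal (x y : S) : \pi x <> \pi y :> P ->
  dotprod (val (sum_diff (x, y)).1) (val (sum_diff (x, y)).2) = 0.
Proof.
move=> xy; apply: direction_orthogonal; [exact: sum_neq0|exact: diff_neq0|].
by rewrite dotprodDB !dotprod_sphere subrr.
Qed.

Lemma sum_diff_values_neq0 (x y : S) : \pi x <> \pi y :> P ->
  sum_diff_values (x, y) != 0.
Proof.
move=> /sum_diff_orthogonal/f_nz[l fl].
by apply: contraNneq fl => /rowP/(_ l); rewrite !mxE => ->.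
Qed.

Lemma sum_diff_values_swap (x y : S) : \pi x <> \pi y :> P ->
  sum_diff_values (y, x) = - sum_diff_values (x, y).
Proof.
move=> xy; apply/rowP => l; rewrite !mxE /sum_diff /=.
rewrite [val y + _]addrC -opprB (directionN (diff_neq0 xy)).
exact: (f_odd l _ _).2.
Qed.

Lemma sum_diff_values_antipode (x y : S) : \pi x <> \pi y :> P ->
  sum_diff_values (antipode x, y) = sum_diff_values (x, y).
Proof.
move=> xy; apply/rowP => l; rewrite !mxE /sum_diff /=.
rewrite addrC -opprB -opprD.
rewrite (directionN (diff_neq0 xy)) (directionN (sum_neq0 xy)).
by rewrite (f_odd l _ _).1 (f_odd l _ _).2 opprK f_sym.
Qed.

Lemma sum_diff_values_pi (x y x' y' : S) :
  \pi x = \pi x' :> P -> \pi y = \pi y' :> P -> \pi x <> \pi y :> P ->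
  sum_diff_values (x, y) = sum_diff_values (x', y').
Proof.
have pi1 (a a' b : S) : \pi a = \pi a' :> P -> \pi a <> \pi b :> P ->
    sum_diff_values (a, b) = sum_diff_values (a', b).
  move=> aa' ab; have a'b : \pi a' <> \pi b :> P by rewrite -aa'.
  case/pi_projectiveE: aa' => [-> //|->].
  exact: sum_diff_values_antipode.
move=> xx' yy' xy; rewrite (pi1 _ _ _ xx' xy).
have x'y : \pi x' <> \pi y :> P by rewrite -xx'.
have yx' : \pi y <> \pi x' :> P by move=> /esym.
(* The second argument is changed by exchanging the two, changing the first,
   and exchanging back. *)
apply: oppr_inj; rewrite -sum_diff_values_swap// (pi1 _ _ _ yy' yx').
by rewrite sum_diff_values_swap// -yy'.
Qed.

Lemma sum_diff_continuous_at (x y : S) : \pi x <> \pi y :> P ->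
  {for (x, y), continuous sum_diff}.
Proof.
move=> xy.
have vc1 : {for (x, y), continuous (fun p : S * S => set_val p.1)}.
  apply: (@continuous_comp (S * S)%type S 'rV[R]_n.+1 fst).
    exact: cvg_fst.
  exact: initial_continuous.
have vc2 : {for (x, y), continuous (fun p : S * S => set_val p.2)}.
  apply: (@continuous_comp (S * S)%type S 'rV[R]_n.+1 snd).
    exact: cvg_snd.
  exact: initial_continuous.
have dc1 : {for (x, y), continuous (fun p : S * S =>
    direction (set_val p.1 + set_val p.2))}.
  apply: (@continuous_comp (S * S)%type 'rV[R]_n.+1 S _ direction).
    exact: cvgD vc1 vc2.
  exact: direction_continuous_at (sum_neq0 xy).
have dc2 : {for (x, y), continuous (fun p : S * S =>
    direction (set_val p.1 - set_val p.2))}.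
  apply: (@continuous_comp (S * S)%type 'rV[R]_n.+1 S _ direction).
    exact: cvgB vc1 vc2.
  exact: direction_continuous_at (diff_neq0 xy).
exact: cvg_pair dc1 dc2.
Qed.

Lemma sum_diff_values_continuous_at (x y : S) : \pi x <> \pi y :> P ->
  {for (x, y), continuous sum_diff_values}.
Proof.
move=> xy; apply: continuous_at_row => l.
apply: (@continuous_comp (S * S)%type (S * S)%type R sum_diff (f l)).
  exact: sum_diff_continuous_at.
exact: f_cont.
Qed.

Lemma equivariant_map_exists : exists g : deleted_square P -> sphere R m.+1,
  continuous g /\ {morph g : p / deleted_swap p >-> antipode p}.
Proof.
exists (fun p => direction (sum_diff_values (repr (val p).1, repr (val p).2))).
split.
  apply: (deleted_square_continuous (h := direction \o sum_diff_values)) => /=.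
    by move=> x y x' y' xx' yy' xy; rewrite (sum_diff_values_pi xx' yy' xy).
  move=> x y xy; apply: continuous_comp.
    exact: sum_diff_values_continuous_at.
  by apply: direction_continuous_at; exact: sum_diff_values_neq0.
move=> p.
have pi_neq : \pi_P (repr (val p).1) <> \pi_P (repr (val p).2).
  by rewrite !reprK; have /set_mem := valP p.
by rewrite /= sum_diff_values_swap// (directionN (sum_diff_values_neq0 pi_neq)).
Qed.

End equivariant_map.

Theorem theorem5 (R : realType) (n m : nat) (n_gt0 : (0 < n)%N)
    (m_gt0 : (0 < m)%N)
    (obstr : deleted_square_obstruction R (projective_space R n) m) :
  R_odd_sym_orth R (n, m, 2%N).
Proof.
case: n m n_gt0 m_gt0 obstr => [//|n] [//|m] _ _ obstr; split=> // f fP.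
apply: contrapT => no_frame; apply: obstr.
apply: (@equivariant_map_exists R n m f) => [l|l|l|x y xy].
- by have [] := fP l.
- by have [] := fP l.
- by have [] := fP l.
apply: contrapT => f0; apply: no_frame.
exists (fun i => if i == 0 then x else y).
  have [/set_mem xx /set_mem yy] := (valP x, valP y).
  move=> i j; case: i j => [[|[|//]] ?] [[|[|//]] ?] //=.
  by rewrite dotprodC.
move=> l [[|[|//]] ?] [[|[|//]] ?] //= _.
by apply/eqP; apply/negPn/negP => fl; apply: f0; exists l.
Qed.
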